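(* Let $t=\{t_k\}_{k=1}^\infty$ and $s=\{s_k\}_{k=1}^\infty$ be non-increasing sequences of positive numbers. Let $n\in\mathbb{N}$, $1<p<\infty$, $q=p/(p-1)$ and $\varepsilon\ge0$. If $$1-\varepsilon\sum_{k=1}^n\frac{1}{t_ks_k}\ge0,$$ set $m=n$. Otherwise let $m\in\mathbb{Z}_+$, $m\le n$, be such that $$1-\varepsilon\sum_{k=1}^m\frac{1}{t_ks_k}\ge0\qquad\text{and}\qquad 1-\varepsilon\sum_{k=1}^{m+1}\frac{1}{t_ks_k}<0.$$ Then $$\mathcal{E}\left(A,W^{T,S}_{p,q},J^n_{\varepsilon,\infty}\right)=\mathcal{E}\left(A,W^{T,S}_{p,q},J^n_{\varepsilon,\infty},\Psi^*_m\right)=t_{m+1}s_{m+1}+\varepsilon\sum_{k=1}^m\left(1-\frac{t_{m+1}s_{m+1}}{t_ks_k}\right).$$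
   Context: $\ell_p$, $\ell_q$ are the usual spaces of complex sequences with norms $\|\cdot\|_p,\|\cdot\|_q$. Put $Th=\{t_kh_k\}_{k=1}^\infty$ for $h\in\ell_p$ and $Sg=\{s_kg_k\}_{k=1}^\infty$ for $g\in\ell_q$. The classes are $W^T_p=\{Th:h\in\ell_p,\|h\|_p\le1\}$, $W^S_q=\{Sg:g\in\ell_q,\|g\|_q\le1\}$ and $W^{T,S}_{p,q}=W^T_p\times W^S_q$. The operator is $A:\ell_p\times\ell_q\to\mathbb{C}$, $A(x,y)=\langle x,y\rangle=\sum_{k=1}^\infty x_ky_k$. $\mathbb{Z}_+=\{0,1,2,\ldots\}$ and $\sum_{k=1}^0a_k:=0$. An information mapping $J$ assigns to each $(x,y)\in\ell_p\times\ell_q$ a non-empty subset $J(x,y)\subset\mathbb{C}^n\times\mathbb{C}^n$. A method of recovery is an arbitrary mapping $\Psi:\mathbb{C}^n\times\mathbb{C}^n\to\mathbb{C}$. Its error is $\mathcal{E}(A,W,J,\Psi)=\sup_{(x,y)\in W}\sup_{(a,b)\in J(x,y)}|\langle x,y\rangle-\Psi(a,b)|$, and $\mathcal{E}(A,W,J)=\inf_\Psi\mathcal{E}(A,W,J,\Psi)$ over all methods $\Psi$. Here $J^n_{\varepsilon,\infty}(x,y)=\{(a,b)\in\mathbb{C}^n\times\mathbb{C}^n:\max_{1\le k\le n}|x_ky_k-a_kb_k|\le\varepsilon\}$. For $1\le m\le n$, $$\Psi^*_m(a,b)=\sum_{k=1}^ma_kb_k\left(1-\frac{t_{m+1}s_{m+1}}{t_ks_k}\right),$$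 and $\Psi^*_0(a,b)=0$. *)

(* Defs.v *)
From mathcomp Require Export all_boot all_order all_algebra.
From mathcomp Require Export all_classical all_reals all_analysis.
From mathcomp Require Export complex.
Export Order.TTheory GRing.Theory Num.Theory.
Export numFieldNormedType.Exports.
Export ComplexField.Normc.

Set Implicit Arguments.
Unset Strict Implicit.
Unset Printing Implicit Defensive.

Local Open Scope classical_set_scope.
Local Open Scope ring_scope.
Local Open Scope complex_scope.

(* Sequences are indexed from 0, so [x k] is the entry x_{k+1} of the usual
   1-based notation; in particular [t m] is t_{m+1}, and \sum_(k < m) runs over
   the first m entries. The modulus is the real-valued [normc], since the
   library norm on R[i] takes its values in R[i]. *)
Definition cseq (R : realType) := nat -> R[i].

Definition lpnorm (R : realType) (p : R) (x : cseq R) : \bar R :=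
  Lnorm (counting : {measure set nat -> \bar R}) p%:E
    (fun k => (normc (x k))%:E).

Definition lp (R : realType) (p : R) : set (cseq R) :=
  [set x | (lpnorm p x < +oo)%E].

Definition diagop (R : realType) (t : nat -> R) (h : cseq R) : cseq R :=
  fun k => (t k)%:C * h k.

Definition Wclass (R : realType) (p : R) (t : nat -> R) : set (cseq R) :=
  [set diagop t h | h in [set h | lp p h /\ (lpnorm p h <= 1)%E]].

(* [R[i]^o] is R[i] with its topology of normed space; the product is bilinear,
   there is no conjugation. *)
Definition pairing (R : realType) (x y : cseq R) : R[i] :=
  lim (series (fun k => x k * y k : R[i]^o) @ \oo).

Definition codes (R : realType) (n : nat) := ('rV[R[i]]_n * 'rV[R[i]]_n)%type.

Definition infomap (R : realType) (n : nat) :=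
  cseq R * cseq R -> set (codes R n).

(* Both suprema are taken in \bar R: the error of a method may be +oo. *)
Definition method_error (R : realType) (n : nat) (W : set (cseq R * cseq R))
    (J : infomap R n) (Psi : codes R n -> R[i]) : \bar R :=
  ereal_sup [set ereal_sup [set (normc (pairing xy.1 xy.2 - Psi ab))%:E
                           | ab in J xy]
            | xy in W].

Definition optimal_error (R : realType) (n : nat) (W : set (cseq R * cseq R))
    (J : infomap R n) : \bar R :=
  ereal_inf [set method_error W J Psi | Psi in [set: codes R n -> R[i]]].

Definition Jinfty (R : realType) (n : nat) (eps : R) : infomap R n :=
  fun xy => [set ab : codes R n | \big[Num.max/0]_(k < n)
    normc (xy.1 k * xy.2 k - ab.1 ord0 k * ab.2 ord0 k) <= eps].

(* Meaningful for m <= n, when k ranges over the first m coordinates. *)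
Definition Psi_star (R : realType) (n : nat) (t s : nat -> R) (m : nat)
    (ab : codes R n) : R[i] :=
  \sum_(k < n | (k < m)%N)
    ab.1 ord0 k * ab.2 ord0 k * (1 - (t m * s m) / (t k * s k))%:C.

(* Main.v *)
From mathcomp Require Import ring lra.
Require Import Defs.
Local Open Scope classical_set_scope.
Local Open Scope ring_scope.
Local Open Scope complex_scope.

(** Write [lam k = t k * s k], [x = T h], [y = S g] and [z k = h k * g k], so
    that [<x, y> = \sum_k lam k * z k], where Hoelder's inequality bounds
    [\sum_k |z k|] by 1. With the weights [c k = 1 - lam m / lam k],
    which are nonnegative for [k < m] because [lam] is nonincreasing, the
    deviation [<x, y> - Psi_star (a, b)] is
      [\sum_(k < m) (x k * y k - a k * b k) * c k
        + \sum_k lam (max m k) * z k].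
    The data are [eps]-accurate and [lam (max m k) <= lam m], hence this is at
    most [eps * \sum_(k < m) c k + lam m] ([Psi_star_error_le]).

    Conversely, let [(x, y)] be in the class with [|x k * y k| <= eps] for
    [k < n]. Then the zero code is admissible for both [(x, y)] and [(- x, y)],
    so any method has error at least [|<x, y>|]: one value has to serve both
    [<x, y>] and [- <x, y>]. Prescribing [z >= 0] with total mass 1 and taking
    [h = z `^ p^-1], [g = z `^ q^-1] turns this into the choice of a mass
    distribution with [lam k * z k <= eps] for [k < n] that makes
    [\sum_k lam k * z k] large ([method_error_ge]). The greedy choice fills the
    coordinates of largest [lam] up to the cap, [z k = eps / lam k] for
    [k < m], and puts the remaining mass [1 - eps * \sum_(k < m) (lam k)^-1] at
    [m]. The definition of [m] says precisely that this remainder is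
    nonnegative and, when [m < n], that it respects the cap at [m]; the value
    obtained equals the upper bound. *)

(** * Modulus and limits of complex sequences *)

Lemma normcE (R : realType) (z : R[i]) : `|z| = (normc z)%:C.
Proof. by rewrite normc_def; case: z. Qed.

Lemma normc_ge0 (R : realType) (z : R[i]) : 0 <= normc z.
Proof. by rewrite -lecR -normcE normr_ge0. Qed.

Lemma normc_real (R : realType) (r : R) : normc r%:C = `|r|.
Proof. by rewrite /normc/= expr0n addr0 sqrtr_sqr. Qed.

(** The triangle inequality and [normcN] for the additive structure of [R[i]]
    itself, as opposed to that of its alias [Rcomplex R]. *)
Lemma ler_normcD (R : realType) (z w : R[i]) :
  normc (z + w) <= normc z + normc w.
Proof. exact: le_normcD. Qed.

Lemma normc_opp (R : realType) (z : R[i]) : normc (- z) = normc z.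
Proof. exact: normcN. Qed.

Lemma ler_normc_sum (R : realType) (I : Type) (r : seq I) (P : pred I)
    (F : I -> R[i]) :
  normc (\sum_(i <- r | P i) F i) <= \sum_(i <- r | P i) normc (F i).
Proof.
apply: (big_ind2 (fun (u : R[i]) v => normc u <= v)) => //.
  by rewrite normc0.
move=> u1 v1 u2 v2 h1 h2; apply: le_trans (lerD h1 h2).
exact: ler_normcD.
Qed.

Lemma cvg_complex (R : realType) (u : nat -> R[i]) (a b : R) :
    (fun k => complex.Re (u k)) @ \oo --> a ->
    (fun k => complex.Im (u k)) @ \oo --> b ->
  (u : nat -> R[i]^o) @ \oo --> (a +i* b : R[i]^o).
Proof.
move=> /cvgrPdist_lt ua /cvgrPdist_lt ub; apply/cvgrPdist_lt => e.
rewrite ltcE/= => /andP[/eqP Ime0 Ree_gt0].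
have e2_gt0 : 0 < complex.Re e / 2 by rewrite divr_gt0.
near=> k.
have -> : e = (complex.Re e)%:C by case: (e) Ime0 => er ei /= ->.
have -> : (a +i* b : R[i]^o) - u k
    = (a - complex.Re (u k))%:C + (0 +i* (b - complex.Im (u k))).
  by case: (u k) => x y; simpc.
apply: le_lt_trans (ler_normD _ _) _.
rewrite !normcE normc_real /normc expr0n add0r sqrtr_sqr -rmorphD ltcR.
rewrite (splitr (complex.Re e)); apply: ltrD; near: k.
- exact: ua.
- exact: ub.
Unshelve. all: by end_near. Qed.

(** The real and imaginary parts are dominated by the modulus, so completeness
    of [R] suffices. *)
Lemma is_cvg_abs_series (R : realType) (z : nat -> R[i]) (B : R) :
    (forall N, \sum_(0 <= k < N) normc (z k) <= B) ->
  cvgn (series (z : nat -> R[i]^o)).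
Proof.
move=> zB.
have zcvg : cvgn (series (fun k => normc (z k))).
  apply: nondecreasing_is_cvgn.
    by apply/nondecreasing_seqP => n; rewrite seriesSr lerDl normc_ge0.
  by exists B => _ [N _ <-]; exact: zB.
have dom (f : R[i] -> R) : (forall w, `|f w| <= normc w) ->
    cvgn (series (fun k => f (z k))).
  move=> fle; apply: (@normed_cvg _ R^o).
  apply: (series_le_cvg _ _ _ zcvg) => k.
  - exact: normr_ge0.
  - exact: normc_ge0.
  - exact: fle.
have reL (w : R[i]) : `|complex.Re w| <= normc w.
  by rewrite -lecR -normcE; exact: normc_ge_Re.
have imL (w : R[i]) : `|complex.Im w| <= normc w.
  case: w => x y /=; rewrite -sqrtr_sqr ler_wsqrtr// lerDr sqr_ge0 //.
have cre := dom _ reL; have cim := dom _ imL.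
apply: (@cvgP _ _ (limn (series (fun k => complex.Re (z k)))
  +i* limn (series (fun k => complex.Im (z k))) : R[i]^o)).
apply: cvg_complex.
- have -> : (fun k => complex.Re (series (z : nat -> R[i]^o) k))
      = series (fun k => complex.Re (z k)).
    by apply/funext => N; rewrite /series/= raddf_sum.
  exact: cre.
- have -> : (fun k => complex.Im (series (z : nat -> R[i]^o) k))
      = series (fun k => complex.Im (z k)).
    by apply/funext => N; rewrite /series/= raddf_sum.
  exact: cim.
Qed.

(** Closed discs are closed under limits, with a radius in [R], whereas the norm
    of [R[i]^o] takes its values in [R[i]]. *)
Lemma lim_normc_le (R : realType) (u : nat -> R[i]) (c : R[i]) (B : R)
    (N0 : nat) :
    cvgn (u : nat -> R[i]^o) ->
    (forall N, (N0 <= N)%N -> normc (u N - c) <= B) ->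
  normc (lim ((u : nat -> R[i]^o) @ \oo) - c) <= B.
Proof.
move=> ucvg uB; apply/ler_addgt0Pr => e e_gt0.
set l : R[i] := lim ((u : nat -> R[i]^o) @ \oo).
have /cvgrPdist_lt/(_ e%:C) : (u : nat -> R[i]^o) @ \oo --> (l : R[i]^o).
  exact: ucvg.
rewrite ltcR => /(_ e_gt0) lu.
near \oo => N.
have -> : l - c = (u N - c) + (l - u N) by rewrite [RHS]addrC subrKA.
apply: le_trans (ler_normcD _ _ _) _; apply: lerD.
  by apply: uB; near: N; exact: nbhs_infty_ge.
rewrite -lecR -normcE; apply: ltW; near: N; exact: lu.
Unshelve. all: by end_near. Qed.

Lemma pairing_fin_support (R : realType) (x y : cseq R) (M : nat) :
    (forall k, (M <= k)%N -> x k * y k = 0) ->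
  pairing x y = \sum_(0 <= k < M) x k * y k.
Proof.
move=> xy0; apply: (@lim_near_cst (R[i]^o)); first exact: norm_hausdorff.
near=> N; rewrite /series/= (@big_cat_nat _ _ _ M 0 N)//=; last first.
  by near: N; exact: nbhs_infty_ge.
rewrite [X in _ + X]big_nat [X in _ + X]big1 ?addr0// => k /andP[Mk _].
exact: xy0.
Unshelve. all: by end_near. Qed.

(** * Unit balls of the sequence spaces *)

(** Hoelder's inequality for the counting measure, truncated to partial sums. *)
Lemma sum_normcM_le1 (R : realType) (p q : R) (h g : cseq R) (N : nat) :
    0 < p -> 0 < q -> p^-1 + q^-1 = 1 ->
    (lpnorm p h <= 1)%E -> (lpnorm q g <= 1)%E ->
  \sum_(0 <= k < N) normc (h k * g k) <= 1.
Proof.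
move=> p0 q0 pq hp gq.
have := @hoelder _ nat R (counting : {measure set nat -> \bar R})
  (fun k => normc (h k)) (fun k => normc (g k)) p q _ _ p0 q0 pq.
move=> /(_ ltac:(by []) ltac:(by [])) H.
have {}H : ('N[counting]_1[EFin \o (fun k => normc (h k) * normc (g k))%R]
    <= 1 :> \bar R)%E.
  apply: le_trans H _; rewrite -[leRHS]mule1.
  by apply: lee_pmul => //; exact: Lnorm_ge0.
rewrite -lee_fin; apply: le_trans H.
rewrite Lnorm1 ge0_integral_count//= -sumEFin.
apply: le_trans (nneseries_lim_ge N _) => //.
apply: lee_sum => k _ /=; rewrite lee_fin normcM ler_norm //.
Qed.

(** The factor [c] of modulus 1 is what allows the extremal sequence and its
    opposite to be treated together. *)
Lemma lpnorm_root_le1 (R : realType) (p c : R) (z : nat -> R) (M : nat) :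
    0 < p -> `|c| = 1 -> (forall k, 0 <= z k) ->
    (forall k, (M <= k)%N -> z k = 0) -> \sum_(0 <= k < M) z k <= 1 ->
  (lpnorm p (fun k => (c * z k `^ p^-1)%:C) <= 1)%E.
Proof.
move=> p0 c1 z0 zM zs.
rewrite /lpnorm Lnorm_counting//.
under eq_eseriesr => k _.
  rewrite normc_real normrM c1 mul1r ger0_norm ?powR_ge0//=.
  rewrite ger0_norm ?powR_ge0// -powRrM mulVf ?gt_eqF// powRr1//.
  over.
rewrite (nneseries_split 0 M)//; last by move=> k; rewrite lee_fin.
rewrite add0n eseries0 ?adde0; last by move=> k Mk _; rewrite zM.
rewrite sumEFin poweR_EFin lee_fin.
have -> : 1 = 1 `^ p^-1 :> R by rewrite powR1.
by apply: ge0_ler_powR; rewrite ?nnegrE ?invr_ge0 ?(ltW p0) ?sumr_ge0.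
Qed.

(** * Upper bound: the error of the weighted method *)

(** Moving [lam m * z k] from each of the first [m] terms to the second sum
    leaves the data error [lam k * z k - w k] weighted by [1 - lam m / lam k],
    and every coefficient of the second sum becomes at most [lam m]. *)
Lemma finite_error_le (R : realType) (lam : nat -> R) (z w : nat -> R[i])
    (eps : R) (m N : nat) :
    (forall k, 0 < lam k) -> nonincreasing_seq lam -> (m <= N)%N ->
    (forall k, (k < m)%N -> normc ((lam k)%:C * z k - w k) <= eps) ->
    \sum_(0 <= k < N) normc (z k) <= 1 ->
  normc (\sum_(0 <= k < N) (lam k)%:C * z k
         - \sum_(0 <= k < m) w k * (1 - lam m / lam k)%:C)
    <= lam m + eps * \sum_(0 <= k < m) (1 - lam m / lam k).
Proof.
move=> lam0 lam_dec mN zw zs.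
have -> : \sum_(0 <= k < N) (lam k)%:C * z k
         - \sum_(0 <= k < m) w k * (1 - lam m / lam k)%:C =
    \sum_(0 <= k < m) ((lam k)%:C * z k - w k) * (1 - lam m / lam k)%:C
    + \sum_(0 <= k < N) (lam (maxn m k))%:C * z k.
  rewrite !(@big_cat_nat _ _ _ m 0 N)//= addrAC addrA; congr (_ + _).
    rewrite -sumrB -big_split/=; apply: eq_big_nat => k /andP[_ km].
    rewrite (maxn_idPl (ltnW km)).
    have -> : (lam m)%:C = (lam k)%:C * (lam m / lam k)%:C.
      by rewrite -rmorphM mulrC divfK// gt_eqF.
    rewrite rmorphB/=; ring.
  apply: eq_big_nat => k /andP[mk _]; by rewrite (maxn_idPr mk).
apply: le_trans (ler_normcD _ _ _) _.
rewrite addrC; apply: lerD.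
  apply: le_trans (ler_normc_sum _ _ _ _ _) _.
  rewrite -[leRHS]mulr1; apply: le_trans (ler_wpM2l (ltW (lam0 m)) zs).
  rewrite mulr_sumr; apply: ler_sum => k _.
  rewrite normcM normc_real gtr0_norm// ler_wpM2r ?normc_ge0//.
  by apply: lam_dec; exact: leq_maxl.
apply: le_trans (ler_normc_sum _ _ _ _ _) _.
rewrite mulr_sumr !big_nat; apply: ler_sum => k /andP[_ km].
have c_ge0 : 0 <= 1 - lam m / lam k.
  by rewrite subr_ge0 ler_pdivrMr// mul1r; apply: lam_dec; exact: ltnW.
rewrite normcM normc_real ger0_norm// ler_wpM2r// zw//.
Qed.

Lemma Psi_star_error_le (R : realType) (t s : nat -> R) (n m : nat)
    (p q eps : R) :
    (forall k, 0 < t k) -> (forall k, 0 < s k) ->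
    nonincreasing_seq t -> nonincreasing_seq s ->
    0 < p -> 0 < q -> p^-1 + q^-1 = 1 -> (m <= n)%N ->
  (method_error (Wclass p t `*` Wclass q s) (@Jinfty R n eps)
      (Psi_star t s m) <=
    (t m * s m + eps * \sum_(k < m) (1 - (t m * s m) / (t k * s k)))%:E)%E.
Proof.
move=> t_gt0 s_gt0 t_noninc s_noninc p_gt0 q_gt0 pq mn.
apply: ge_ereal_sup => _ [[x y] [[/= h [_ hp] <-] [g [_ gq] <-]] <-].
apply: ge_ereal_sup => _ [ab /bigmax_leP[_ Jab] <-]; rewrite lee_fin.
pose lam k := t k * s k; pose z k := h k * g k.
(* The code, extended by 0 beyond [n] to be indexed by [nat]. *)
pose w k := if insub k is Some i then ab.1 ord0 i * ab.2 ord0 i else 0 : R[i].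
have lam0 k : 0 < lam k by rewrite mulr_gt0.
have lam_dec : nonincreasing_seq lam.
  move=> i j ij; apply: ler_pM; [exact: ltW|exact: ltW| |].
  - exact: t_noninc.
  - exact: s_noninc.
have zs N : \sum_(0 <= k < N) normc (z k) <= 1 by exact: (sum_normcM_le1 _ p q).
have xyE k : diagop t h k * diagop s g k = (lam k)%:C * z k.
  by rewrite /diagop /lam /z rmorphM/= mulrACA.
have wE (i : 'I_n) : w i = ab.1 ord0 i * ab.2 ord0 i by rewrite /w valK.
have zw k : (k < m)%N -> normc ((lam k)%:C * z k - w k) <= eps.
  move=> km; have kn := leq_trans km mn.
  by have := Jab (Ordinal kn) isT; rewrite -wE /= xyE.
have -> : Psi_star t s m ab = \sum_(0 <= k < m) w k * (1 - lam m / lam k)%:C.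
  rewrite big_mkord.
  rewrite (big_ord_widen n (fun k => w k * (1 - lam m / lam k)%:C))//.
  by apply: eq_bigr => i _; rewrite wE.
rewrite -(big_mkord xpredT (fun k => 1 - lam m / lam k)).
apply: (@lim_normc_le _ _ _ _ m).
  (* The largest weight [lam 0] bounds all the partial sums. *)
  apply: (@is_cvg_abs_series _ _ (lam 0%N)) => N.
  rewrite -[leRHS]mulr1; apply: le_trans (ler_wpM2l (ltW (lam0 0%N)) (zs N)).
  rewrite mulr_sumr; apply: ler_sum => k _.
  rewrite xyE normcM normc_real gtr0_norm// ler_wpM2r ?normc_ge0//.
  by apply: lam_dec.
move=> N mN; rewrite /series/=.
under eq_bigr do rewrite xyE.
exact: finite_error_le.
Qed.

(** * Lower bound: indistinguishable pairs *)

(** The pairs [(x, y)] and [(- x, y)] built from [z] both admit the zero code,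
    while their pairings are opposite. *)
Lemma method_error_ge (R : realType) (t s : nat -> R) (n : nat) (p q eps : R)
    (Psi : codes R n -> R[i]) (M : nat) (z : nat -> R) :
    (forall k, 0 < t k) -> (forall k, 0 < s k) ->
    0 < p -> 0 < q -> p^-1 + q^-1 = 1 ->
    (forall k, 0 <= z k) -> (forall k, (M <= k)%N -> z k = 0) ->
    \sum_(0 <= k < M) z k <= 1 -> 0 <= eps ->
    (forall k, (k < n)%N -> t k * s k * z k <= eps) ->
  ((\sum_(0 <= k < M) t k * s k * z k)%:E <=
    method_error (Wclass p t `*` Wclass q s) (@Jinfty R n eps) Psi)%E.
Proof.
set W := Wclass p t `*` Wclass q s; set J := @Jinfty R n eps.
move=> t_gt0 s_gt0 p_gt0 q_gt0 pq z0 zM zs eps0 zeps.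
(* [x (- 1)] is the opposite of [x 1]; the factor 1 in [y] lets the same norm
   estimate apply to both sequences. *)
pose x c : cseq R := diagop t (fun k => (c * z k `^ p^-1)%:C).
pose y : cseq R := diagop s (fun k => (1 * z k `^ q^-1)%:C).
have xyE c k : x c k * y k = (c * (t k * s k * z k))%:C.
  rewrite /x /y /diagop -!rmorphM/=; congr (_%:C).
  rewrite mul1r.
  have {3}-> : z k = z k `^ p^-1 * z k `^ q^-1.
    by rewrite -powRD pq ?powRr1// oner_eq0.
  ring.
set v := \sum_(0 <= k < M) t k * s k * z k.
have pairE c : pairing (x c) y = (c * v)%:C.
  rewrite (@pairing_fin_support _ _ _ M); last first.
    by move=> k Mk; rewrite xyE zM// !mulr0.
  by rewrite /v mulr_sumr rmorph_sum/=; apply: eq_bigr => k _; rewrite xyE.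
have err c : `|c| = 1 ->
    ((normc ((c * v)%:C - Psi (0, 0)))%:E <= method_error W J Psi)%E.
  move=> c1.
  have xyW : W (x c, y).
    split=> /=; [exists (fun k => (c * z k `^ p^-1)%:C) => //
                |exists (fun k => (1 * z k `^ q^-1)%:C) => //].
      suff hp : (lpnorm p (fun k => (c * z k `^ p^-1)%:C) <= 1)%E.
        by split=> //; apply: le_lt_trans hp _; rewrite ltry.
      exact: (lpnorm_root_le1 _ _ _ _ M).
    suff gq : (lpnorm q (fun k => (1 * z k `^ q^-1)%:C) <= 1)%E.
      by split=> //; apply: le_lt_trans gq _; rewrite ltry.
    apply: (lpnorm_root_le1 _ _ _ _ M) => //; exact: normr1.
  apply: le_trans (ereal_sup_ubound _); last by exists (x c, y).
  apply: ereal_sup_ubound; exists (0, 0); last by rewrite /= pairE.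
  apply/bigmax_leP; split=> // k _ /=.
  rewrite !mxE mulr0 subr0 xyE normc_real normrM c1 mul1r.
  by rewrite ger0_norm ?zeps// !mulr_ge0// ltW.
have := err 1 (normr1 _); have := err (- 1) (normrN1 _).
case: (method_error W J Psi) => [r| |]; rewrite ?leey ?leeNy_eq //.
rewrite !lee_fin mul1r mulN1r => le2 le1.
have : normc (v *+ 2)%:C <= r + r.
  apply: le_trans (lerD le1 le2).
  have -> : (v *+ 2)%:C = (v%:C - Psi (0, 0)) + - ((- v)%:C - Psi (0, 0)).
    by rewrite opprB addrA subrK -rmorphB/= opprK mulr2n.
  apply: le_trans (ler_normcD _ _ _) _.
  by rewrite normc_opp.
rewrite normc_real => /(le_trans (ler_norm _)); lra.
Qed.

(** For [lam] nonincreasing and [m] as in the theorem, this [z] maximizes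
    [\sum_k lam k * z k] among the [z >= 0] of total mass 1 with
    [lam k * z k <= eps] for [k < n]: the first coordinates are the most
    profitable, and [eps / lam k] saturates the constraint there. *)
Definition greedy_mass {R : realType} (lam : nat -> R) (eps : R) (m : nat) :
    nat -> R :=
  fun k => if (k < m)%N then eps / lam k
           else if k == m then 1 - eps * \sum_(i < m) (lam i)^-1 else 0.

Lemma sum_greedy_mass (R : realType) (lam mu : nat -> R) (eps : R) (m : nat) :
  \sum_(0 <= k < m.+1) mu k * greedy_mass lam eps m k
    = eps * \sum_(k < m) mu k / lam k
      + mu m * (1 - eps * \sum_(k < m) (lam k)^-1).
Proof.
rewrite big_mkord big_ord_recr/= {2}/greedy_mass ltnn eqxx; congr (_ + _).
rewrite mulr_sumr; apply: eq_bigr => k _.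
by rewrite /greedy_mass ltn_ord mulrCA.
Qed.

(** * The optimal error *)

Theorem theorem9 (R : realType) (t s : nat -> R)
  (t_gt0 : forall k, 0 < t k) (s_gt0 : forall k, 0 < s k)
  (t_noninc : nonincreasing_seq t) (s_noninc : nonincreasing_seq s)
  (n : nat) (n_gt0 : (0 < n)%N)
  (p q : R) (p_gt1 : 1 < p) (q_def : q = p / (p - 1))
  (eps : R) (eps_ge0 : 0 <= eps)
  (m : nat)
  (m_def : if 0 <= 1 - eps * \sum_(k < n) (t k * s k)^-1
           then m = n
           else [/\ (m <= n)%N,
                    0 <= 1 - eps * \sum_(k < m) (t k * s k)^-1
                  & 1 - eps * \sum_(k < m.+1) (t k * s k)^-1 < 0]) :
  let W := Wclass p t `*` Wclass q s in
  let J := @Jinfty R n eps in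
  optimal_error W J = method_error W J (Psi_star t s m) /\
  method_error W J (Psi_star t s m) =
    (t m * s m
     + eps * \sum_(k < m) (1 - (t m * s m) / (t k * s k)))%:E.
Proof.
move=> W J.
have p0 : 0 < p by apply: lt_trans p_gt1.
have p10 : 0 < p - 1 by rewrite subr_gt0.
have q0 : 0 < q by rewrite q_def divr_gt0.
have pq : p^-1 + q^-1 = 1.
  by rewrite q_def; field; rewrite (gt_eqF p0) (gt_eqF p10).
pose lam k := t k * s k.
have lam0 k : 0 < lam k by rewrite mulr_gt0.
(* The mass left for coordinate [m] is nonnegative, and failure of the condition
   at [m.+1] means that it does not exceed [eps / lam m]. *)
have [mn rest_ge0 rest_cap] : [/\ (m <= n)%N,
    0 <= 1 - eps * \sum_(k < m) (lam k)^-1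
  & (m < n)%N -> lam m * (1 - eps * \sum_(k < m) (lam k)^-1) <= eps].
  case: ifP m_def => [h ->|_ [mn h1 h2]]; first by rewrite ltnn.
  split=> // _; move: h2; rewrite big_ord_recr/= mulrDr opprD addrA subr_lt0.
  by move=> /ltW; rewrite ler_pdivlMr ?lam0// mulrC.
have upper := Psi_star_error_le _ _ _ _ _ _ _ eps
  t_gt0 s_gt0 t_noninc s_noninc p0 q0 pq mn.
set V := t m * s m + _ in upper *.
pose z := greedy_mass lam eps m.
have z_ge0 k : 0 <= z k.
  rewrite /z /greedy_mass; case: ifP => _; first by rewrite divr_ge0// ltW.
  by case: ifP.
have z_supp k : (m.+1 <= k)%N -> z k = 0.
  by move=> mk; rewrite /z /greedy_mass ltnNge (ltnW mk)/= gtn_eqF.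
have z_mass : \sum_(0 <= k < m.+1) z k <= 1.
  have := sum_greedy_mass _ lam (fun=> 1) eps m.
  under eq_bigr do rewrite mul1r.
  under [in RHS]eq_bigr do rewrite mul1r.
  by rewrite mul1r addrC subrK => ->.
have z_cap k : (k < n)%N -> t k * s k * z k <= eps.
  move=> kn; rewrite -/(lam k) /z /greedy_mass.
  case: ifP => _; first by rewrite mulrC divfK// gt_eqF.
  case: eqP => [km|_]; last by rewrite mulr0.
  by rewrite km rest_cap// -km.
have z_val : \sum_(0 <= k < m.+1) t k * s k * z k = V.
  rewrite (sum_greedy_mass _ lam lam) /V -/(lam m).
  have -> : \sum_(k < m) lam k / lam k = \sum_(k < m) 1.
    by apply: eq_bigr => k _; rewrite divff// gt_eqF.
  have -> : \sum_(k < m) (1 - lam m / lam k)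
      = \sum_(k < m) 1 - lam m * \sum_(k < m) (lam k)^-1.
    by rewrite mulr_sumr -sumrB.
  ring.
have lower Psi : (V%:E <= method_error W J Psi)%E.
  by rewrite -z_val; exact: (method_error_ge _ _ _ _ p q).
have star : method_error W J (Psi_star t s m) = V%:E.
  by apply/eqP; rewrite eq_le upper lower.
split=> //; apply/eqP; rewrite eq_le; apply/andP; split.
  by apply: ereal_inf_lbound; exists (Psi_star t s m).
by rewrite star; apply: le_ereal_inf_tmp => _ [Psi _ <-]; exact: lower.
Qed.
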